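(* Let $v_1,\dots,v_n\in\mathbb{R}^d$ be vectors with $\sum_{i=1}^n v_i=0$, and let $\alpha_1\ge\alpha_2\ge\dots\ge\alpha_n\ge 0$ be real numbers. Set $\beta=\alpha_{\lfloor n/2\rfloor+1}$. Then for every permutation $\sigma$ of $[n]$, $$\left\|\sum_{i=1}^n \alpha_i v_{\sigma(i)}\right\|\le \max_{i\in[n]}\|v_i\|\,\sum_{i=1}^n|\alpha_i-\beta|.$$
   Context: $[n]=\{1,\dots,n\}$, and $\|\cdot\|$ is the Euclidean norm on $\mathbb{R}^d$. The vectors $v_1,\dots,v_n$ are an indexed family and need not be distinct. *)

(* Defs.v *)
From mathcomp Require Import all_boot all_order all_algebra all_fingroup reals.

Set Implicit Arguments.
Unset Strict Implicit.
Unset Printing Implicit Defensive.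

Import Order.TTheory GRing.Theory Num.Theory.
Local Open Scope ring_scope.

(* Not the norm [`|v|] that MathComp-Analysis puts on 'rV[R]_d, which is the
   sup norm. *)
Definition euclid_norm (R : realType) (d : nat) (v : 'rV[R]_d) : R :=
  Num.sqrt (\sum_(j < d) v 0 j ^+ 2).

Lemma half_lt_pos (n : nat) : (0 < n)%N -> (n./2 < n)%N.
Proof.
by move=> n_gt0; rewrite ltn_half_double -addnn -{1}[n]addn0 ltn_add2l.
Qed.

(* Indices of 'I_n start at 0, so the 1-based position floor(n/2) + 1 is the
   ordinal of value n./2. *)
Definition mid_ord (n : nat) (n_gt0 : (0 < n)%N) : 'I_n :=
  Ordinal (half_lt_pos n_gt0).

(* The default 0 is harmless for n > 0, as norms are nonnegative. *)
Definition max_norm (R : realType) (n d : nat) (v : 'I_n -> 'rV[R]_d) : R :=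
  \big[Num.max/0]_(i < n) euclid_norm (v i).

(* Main.v *)
Require Import Defs.
From mathcomp Require Import all_boot all_order all_algebra all_fingroup reals.
From mathcomp Require Import ring.
Import Order.TTheory GRing.Theory Num.Theory.
Local Open Scope ring_scope.

(** Since the vectors [v (sigma i)] sum to zero, every weight [alpha i] may be
    shifted by the same constant without changing the weighted sum.  After
    shifting by [beta], the triangle inequality bounds the norm of the sum by
    the sum of the [`|alpha i - beta|] times the norms of the [v (sigma i)],
    each of which is at most [max_norm v].  The triangle inequality for the
    Euclidean norm, [euclid_normD], rests on [cauchy_schwarz_sum]. *)

(** The double sum over [j] and [k] of the squares
    [(x j * y k - x k * y j) ^+ 2] is nonnegative, and expanding it gives twice
    the difference of the two sides (Lagrange's identity). *)
Lemma cauchy_schwarz_sum (R : realDomainType) (I : finType) (x y : I -> R) :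
  (\sum_j x j * y j) ^+ 2 <= (\sum_j x j ^+ 2) * (\sum_j y j ^+ 2).
Proof.
have lagrange : \sum_j \sum_k (x j * y k - x k * y j) ^+ 2 =
    ((\sum_j x j ^+ 2) * (\sum_j y j ^+ 2) - (\sum_j x j * y j) ^+ 2) *+ 2.
  have expand j k : (x j * y k - x k * y j) ^+ 2 =
      x j ^+ 2 * y k ^+ 2 + y j ^+ 2 * x k ^+ 2
      - ((x j * y j) * (x k * y k)) *+ 2 by ring.
  under eq_bigr do under eq_bigr do rewrite expand.
  under eq_bigr do rewrite sumrB big_split /= -!mulr_sumr sumrMnl -mulr_sumr.
  rewrite sumrB big_split /= sumrMnl -!mulr_suml -expr2.
  by rewrite [X in _ + X - _]mulrC -mulr2n -mulrnBl.
rewrite -subr_ge0 -(pmulrn_lge0 _ (isT : 0 < 2)%N) -lagrange.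
by apply: sumr_ge0 => j _; apply: sumr_ge0 => k _; apply: sqr_ge0.
Qed.

Lemma euclid_norm_ge0 (R : realType) (d : nat) (u : 'rV[R]_d) :
  0 <= euclid_norm u.
Proof. exact: sqrtr_ge0. Qed.

Lemma sqr_euclid_norm (R : realType) (d : nat) (u : 'rV[R]_d) :
  euclid_norm u ^+ 2 = \sum_j u 0 j ^+ 2.
Proof. by rewrite sqr_sqrtr // sumr_ge0 // => j _; apply: sqr_ge0. Qed.

Lemma euclid_norm0 (R : realType) (d : nat) :
  euclid_norm (0 : 'rV[R]_d) = 0.
Proof.
by rewrite /euclid_norm big1 ?sqrtr0 // => j _; rewrite mxE expr0n.
Qed.

Lemma euclid_normZ (R : realType) (d : nat) (a : R) (u : 'rV[R]_d) :
  euclid_norm (a *: u) = `|a| * euclid_norm u.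
Proof.
rewrite /euclid_norm -sqrtr_sqr -sqrtrM ?sqr_ge0 // mulr_sumr.
by under eq_bigr do rewrite mxE exprMn.
Qed.

Lemma euclid_normD (R : realType) (d : nat) (u w : 'rV[R]_d) :
  euclid_norm (u + w) <= euclid_norm u + euclid_norm w.
Proof.
rewrite -ler_sqr ?nnegrE ?addr_ge0 ?euclid_norm_ge0 //.
rewrite sqrrD !sqr_euclid_norm.
under eq_bigr do rewrite mxE sqrrD.
rewrite !big_split /= -mulr2n lerD2r lerD2l lerMn2r /=.
apply: le_trans (ler_norm _) _.
rewrite -ler_sqr ?nnegrE ?mulr_ge0 ?euclid_norm_ge0 //.
by rewrite real_normK ?num_real // exprMn !sqr_euclid_norm cauchy_schwarz_sum.
Qed.

Lemma ler_euclid_norm_sum (R : realType) (d : nat) (I : finType)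
    (u : I -> 'rV[R]_d) :
  euclid_norm (\sum_i u i) <= \sum_i euclid_norm (u i).
Proof.
apply: (big_ind2 (fun x r => euclid_norm x <= r)) => [|x r y s le_xr le_ys|//].
  by rewrite euclid_norm0.
by apply: le_trans (euclid_normD _ _ _ _) _; apply: lerD.
Qed.

Theorem theorem2 (R : realType) (n d : nat) (n_gt0 : (0 < n)%N)
    (v : 'I_n -> 'rV[R]_d) (alpha : 'I_n -> R)
    (sum_v : \sum_(i < n) v i = 0)
    (alpha_noninc : forall i j : 'I_n, (i <= j)%N -> alpha j <= alpha i)
    (alpha_ge0 : forall i : 'I_n, 0 <= alpha i) :
  let beta := alpha (mid_ord n_gt0) in
  forall sigma : 'S_n,
    euclid_norm (\sum_(i < n) alpha i *: v (sigma i))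
      <= max_norm v * \sum_(i < n) `|alpha i - beta|.
Proof.
move=> beta sigma.
have sum_v_sigma : \sum_i v (sigma i) = 0.
  by rewrite -[RHS]sum_v [RHS](reindex_inj (@perm_inj _ sigma)).
have -> : \sum_i alpha i *: v (sigma i) =
    \sum_i (alpha i - beta) *: v (sigma i).
  under [RHS]eq_bigr do rewrite scalerBl.
  by rewrite sumrB -scaler_sumr sum_v_sigma scaler0 subr0.
apply: le_trans (ler_euclid_norm_sum _ _ _ _) _.
rewrite mulr_sumr; apply: ler_sum => i _.
rewrite euclid_normZ mulrC ler_wpM2r //.
exact: (le_bigmax_cond _ (fun j => euclid_norm (v j))).
Qed.
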